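(* Let $R$ be a $\phi$-ring. Then the following statements are equivalent: (1) $R$ is a $\phi$-Dedekind ring and a strong $\phi$-ring; (2) every divisible $R$-module is nonnil-injective; (3) every $h$-divisible $R$-module is nonnil-injective; (4) every nonnil ideal of $R$ is projective.
   Context: All rings are commutative with identity and all modules are unitary. $\mathrm{Nil}(R)$ is the set of nilpotent elements and $\mathrm{Z}(R)$ the set of zero-divisors (including $0$) of $R$; an element is regular if it is not a zero-divisor. $R$ is a $\phi$-ring if $\mathrm{Nil}(R)$ is a divided prime ideal, i.e. $\mathrm{Nil}(R)$ is a prime ideal and $\mathrm{Nil}(R)\subsetneq (x)$ for every $x\in R\setminus \mathrm{Nil}(R)$. A strong $\phi$-ring is a $\phi$-ring with $\mathrm{Z}(R)=\mathrm{Nil}(R)$. $\mathrm{T}(R)$ is the localization of $R$ at the set of all regular elements. For a $\phi$-ring $R$, $\phi:\mathrm{T}(R)\to R_{\mathrm{Nil}(R)}$ is the ring homomorphism $\phi(a/b)=a/b$, and $\phi(R)$ denotes the image of $R$ (i.e. the image of $R\to R_{\mathrm{Nil}(R)}$, $r\mapsto r/1$); for an ideal $I$ of $R$, $\phi(I)$ is its image, an ideal of $\phi(R)$. An ideal is regular if it contains a regular element. A regular ideal $J$ of a ring $A$ is invertible if $JJ^{-1}=A$, where $J^{-1}=\{x\in \mathrm{T}(A): Jx\subseteq A\}$. An ideal of $R$ is nonnil if it contains a non-nilpotent element. A nonnil ideal $I$ of a $\phi$-ring $R$ is $\phi$-invertible if $\phi(I)$ is an invertible ideal of $\phi(R)$.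 A $\phi$-ring $R$ is $\phi$-Dedekind if every nonnil ideal of $R$ is $\phi$-invertible. An $R$-module $E$ is divisible if $sE=E$ for every regular element $s\in R$; it is $h$-divisible if it is a quotient of an injective module. An $R$-module $T$ is $\phi$-torsion if for every $x\in T$ there is a nonnil ideal $I$ of $R$ with $Ix=0$. An $R$-module $M$ is nonnil-injective if $\operatorname{Ext}^1_R(T,M)=0$ for every $\phi$-torsion $R$-module $T$. *)

(* Defs.v *)
From HB Require Import structures.
From mathcomp Require Import all_boot all_order all_algebra.
From mathcomp Require Import generic_quotient ring_quotient boolp ring.

Set Implicit Arguments.
Unset Strict Implicit.
Unset Printing Implicit Defensive.

Import GRing.Theory.

Local Open Scope ring_scope.
Local Open Scope quotient_scope.

(* Subsets that carry algebraic structure are boolean predicates, as in       *)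
(* ssralg; through asbool, `[< _ >], these are all the subsets.  An ideal of  *)
(* R is a submodule of the regular module R^o, so that R itself is an ideal.  *)

Definition nilradical (R : pzRingType) : {pred R} :=
  fun x => `[< exists n : nat, x ^+ n = 0 >].
Arguments nilradical R _ : clear implicits.

(* 0 is a zero-divisor of every nonzero ring: take y = 1. *)
Definition zero_divisor (R : pzRingType) : {pred R} :=
  fun x => `[< exists2 y : R, y != 0 & x * y = 0 >].
Arguments zero_divisor R _ : clear implicits.

Definition regular_elt (R : pzRingType) : {pred R} :=
  fun x => x \notin zero_divisor R.
Arguments regular_elt R _ : clear implicits.

Lemma regular_elt_mulr_closed (R : comPzRingType) : mulr_closed (regular_elt R).
Proof.
have regP (x : R) : reflect (forall y, x * y = 0 -> y = 0) (x \in regular_elt R).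
  apply: (iffP idP) => [xreg y xy0 | xreg].
    by apply/eqP; apply: contraNT xreg => y0; apply/asboolP; exists y.
  by apply/asboolPn => -[y /eqP y0 /xreg].
split=> [|x y /regP xreg /regP yreg]; apply/regP => z.
  by rewrite mul1r.
by rewrite -mulrA => /xreg /yreg.
Qed.

HB.instance Definition _ (R : comPzRingType) :=
  GRing.isMulClosed.Build R (regular_elt R) (@regular_elt_mulr_closed R).

(* Localization of R at a multiplicative set S: pairs (a, s) modulo           *)
(* (a, s) ~ (b, t) iff u a t = u b s for some u in S.                         *)
Section Localization.
Context (R : comPzRingType) (S : mulrClosed R).

Definition loc_pair : Type := R * {s : R | s \in S}.
Implicit Types x y z : loc_pair.

Definition loc_num x : R := x.1.
Definition loc_den x : R := val x.2.

Lemma loc_denP x : loc_den x \in S. Proof. exact: (valP x.2). Qed.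

Definition loc_mk (a s : R) (sS : s \in S) : loc_pair := (a, exist _ s sS).

Definition loc_equiv x y : bool :=
  `[< exists2 u, u \in S &
        u * (loc_num x * loc_den y) = u * (loc_num y * loc_den x) >].

Lemma loc_equiv_refl : reflexive loc_equiv.
Proof. by move=> x; apply/asboolP; exists 1; rewrite ?rpred1. Qed.

Lemma loc_equiv_sym : symmetric loc_equiv.
Proof. by move=> x y; apply/asboolP/asboolP => -[u uS e]; exists u. Qed.

Lemma loc_equiv_trans : transitive loc_equiv.
Proof.
move=> y x z /asboolP[u uS e] /asboolP[v vS f]; apply/asboolP.
exists (u * v * loc_den y); first by rewrite !rpredM ?loc_denP.
transitivity (u * (loc_num x * loc_den y) * (v * loc_den z)); first by ring.
rewrite e.
transitivity (v * (loc_num y * loc_den z) * (u * loc_den x)); first by ring.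
by rewrite f; ring.
Qed.

Canonical loc_equivRel :=
  EquivRel loc_equiv loc_equiv_refl loc_equiv_sym loc_equiv_trans.

Definition loc := {eq_quot loc_equiv}.

HB.instance Definition _ : EqQuotient _ loc_equiv loc := EqQuotient.on loc.
HB.instance Definition _ := Choice.on loc.

Lemma loc_repr x : exists2 u, u \in S &
  u * (loc_num x * loc_den (repr (\pi_loc x)))
    = u * (loc_num (repr (\pi_loc x)) * loc_den x).
Proof.
have /eqmodP e := reprK (\pi_loc x).
apply/asboolP.
by change (loc_equiv x (repr (\pi_loc x))); rewrite loc_equiv_sym.
Qed.

Definition loc_zero_pair : loc_pair := loc_mk 0 (rpred1 S).
Definition loc_one_pair : loc_pair := loc_mk 1 (rpred1 S).
Definition loc_addf x y : loc_pair :=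
  loc_mk (loc_num x * loc_den y + loc_num y * loc_den x)
    (rpredM (loc_denP x) (loc_denP y)).
Definition loc_oppf x : loc_pair := loc_mk (- loc_num x) (loc_denP x).
Definition loc_mulf x y : loc_pair :=
  loc_mk (loc_num x * loc_num y) (rpredM (loc_denP x) (loc_denP y)).

Definition loc_zero : loc := \pi_loc loc_zero_pair.
Definition loc_one : loc := \pi_loc loc_one_pair.
Definition loc_add := lift_op2 loc loc_addf.
Definition loc_opp := lift_op1 loc loc_oppf.
Definition loc_mul := lift_op2 loc loc_mulf.

Lemma loc_pi_add : {morph \pi : x y / loc_addf x y >-> loc_add x y}.
Proof.
move=> x y; unlock loc_add; apply/eqmodP/asboolP.
have [u uS e] := loc_repr x; have [v vS f] := loc_repr y.
exists (u * v); first exact: rpredM.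
move: x y (repr _) (repr _) e f
  => [a [s sS]] [b [t tS]] [b' [t' ?]] [a' [s' ?]].
rewrite /loc_addf /loc_mulf /loc_num /loc_den /= => e f.
transitivity (u * (a * s') * (v * t * t') + v * (b * t') * (u * s * s')).
  by ring.
by rewrite e f; ring.
Qed.
Canonical loc_pi_add_morph := PiMorph2 loc_pi_add.

Lemma loc_pi_opp : {morph \pi : x / loc_oppf x >-> loc_opp x}.
Proof.
move=> x; unlock loc_opp; apply/eqmodP/asboolP.
have [u uS e] := loc_repr x; exists u => //.
by move: e; rewrite /loc_num /loc_den /= !mulNr !mulrN => ->.
Qed.
Canonical loc_pi_opp_morph := PiMorph1 loc_pi_opp.

Lemma loc_pi_mul : {morph \pi : x y / loc_mulf x y >-> loc_mul x y}.
Proof.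
move=> x y; unlock loc_mul; apply/eqmodP/asboolP.
have [u uS e] := loc_repr x; have [v vS f] := loc_repr y.
exists (u * v); first exact: rpredM.
move: x y (repr _) (repr _) e f
  => [a [s sS]] [b [t tS]] [b' [t' ?]] [a' [s' ?]].
rewrite /loc_addf /loc_mulf /loc_num /loc_den /= => e f.
transitivity (u * (a * s') * (v * (b * t'))); first by ring.
by rewrite e f; ring.
Qed.
Canonical loc_pi_mul_morph := PiMorph2 loc_pi_mul.

Lemma loc_eq x y :
  loc_num x * loc_den y = loc_num y * loc_den x -> \pi_loc x = \pi_loc y.
Proof. by move=> e; apply/eqmodP/asboolP; exists 1; rewrite ?rpred1 ?e. Qed.

Local Ltac loc_ring :=
  apply: loc_eq; rewrite /loc_addf /loc_oppf /loc_mulf /loc_num /loc_den /=;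
  ring.

Fact loc_addA : associative loc_add.
Proof.
elim/quotW=> x; elim/quotW=> y; elim/quotW=> z; rewrite -!loc_pi_add.
by loc_ring.
Qed.

Fact loc_addC : commutative loc_add.
Proof.
elim/quotW=> x; elim/quotW=> y; rewrite -!loc_pi_add.
by loc_ring.
Qed.

Fact loc_add0 : left_id loc_zero loc_add.
Proof.
elim/quotW=> x; rewrite -!loc_pi_add.
by loc_ring.
Qed.

Fact loc_addN : left_inverse loc_zero loc_opp loc_add.
Proof.
elim/quotW=> x; rewrite -!loc_pi_opp -!loc_pi_add.
by loc_ring.
Qed.

HB.instance Definition _ :=
  GRing.isZmodule.Build loc loc_addA loc_addC loc_add0 loc_addN.

Fact loc_mulA : associative loc_mul.
Proof.
elim/quotW=> x; elim/quotW=> y; elim/quotW=> z; rewrite -!loc_pi_mul.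
by loc_ring.
Qed.

Fact loc_mulC : commutative loc_mul.
Proof.
elim/quotW=> x; elim/quotW=> y; rewrite -!loc_pi_mul.
by loc_ring.
Qed.

Fact loc_mul1 : left_id loc_one loc_mul.
Proof.
elim/quotW=> x; rewrite -!loc_pi_mul.
by loc_ring.
Qed.

Fact loc_mulDl : left_distributive loc_mul loc_add.
Proof.
elim/quotW=> x; elim/quotW=> y; elim/quotW=> z.
rewrite -!(loc_pi_add, loc_pi_mul).
by loc_ring.
Qed.

HB.instance Definition _ :=
  GRing.Zmodule_isComPzRing.Build loc loc_mulA loc_mulC loc_mul1 loc_mulDl.

Definition loc_inj (a : R) : loc := \pi_loc (loc_mk a (rpred1 S)).

Fact loc_inj_zmod_morphism : zmod_morphism loc_inj.
Proof.
move=> a b; rewrite /loc_inj -[RHS]/(loc_add _ (loc_opp _)).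
rewrite -loc_pi_opp -loc_pi_add.
by loc_ring.
Qed.

Fact loc_inj_monoid_morphism : monoid_morphism loc_inj.
Proof.
split=> // a b; rewrite /loc_inj -[RHS]/(loc_mul _ _) -loc_pi_mul.
by loc_ring.
Qed.

HB.instance Definition _ :=
  GRing.isZmodMorphism.Build R loc loc_inj loc_inj_zmod_morphism.
HB.instance Definition _ :=
  GRing.isMonoidMorphism.Build R loc loc_inj loc_inj_monoid_morphism.

End Localization.

Definition total_ring (A : comPzRingType) : comPzRingType :=
  loc (regular_elt A).

Definition to_total (A : comPzRingType) : {rmorphism A -> total_ring A} :=
  loc_inj (regular_elt A).

Definition principal_ideal (R : comPzRingType) (x : R) : {pred R} :=
  fun y => `[< exists r, y = x * r >].

Definition divided_prime (R : comNzRingType) (P : {pred R}) : Prop :=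
  [/\ idealr_closed P, prime_idealr_closed P &
      forall x, x \notin P ->
        {subset P <= principal_ideal x} /\ ~ {subset principal_ideal x <= P}].

Definition phi_ring (R : comNzRingType) : Prop :=
  divided_prime (nilradical R).

Definition strong_phi_ring (R : comNzRingType) : Prop :=
  phi_ring R /\ zero_divisor R =i nilradical R.

Definition nonnil_elt (R : comNzRingType) (hR : phi_ring R) : {pred R} :=
  fun x => x \notin nilradical R.

Lemma nonnil_elt_mulr_closed (R : comNzRingType) (hR : phi_ring R) :
  mulr_closed (nonnil_elt hR).
Proof.
have [[_ nil1 _] prim _] := hR.
split=> // x y xS yS; apply/negP => /prim /orP[]; exact/negP.
Qed.

HB.instance Definition _ (R : comNzRingType) (hR : phi_ring R) :=
  GRing.isMulClosed.Build R (nonnil_elt hR) (nonnil_elt_mulr_closed hR).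

Definition loc_nil (R : comNzRingType) (hR : phi_ring R) : comPzRingType :=
  loc (nonnil_elt hR).

Definition to_loc_nil (R : comNzRingType) (hR : phi_ring R) :
  {rmorphism R -> loc_nil hR} := loc_inj (nonnil_elt hR).

(* phi(R) is the image of R in the localization of R at Nil(R). *)
Definition in_phi_image (R : comNzRingType) (hR : phi_ring R) :
  {pred loc_nil hR} := fun y => `[< exists r, y = to_loc_nil hR r >].
Arguments in_phi_image {R} hR _.

Lemma in_phi_image_subring_closed (R : comNzRingType) (hR : phi_ring R) :
  subring_closed (in_phi_image hR).
Proof.
split=> [|_ _ /asboolP[r ->] /asboolP[s ->]|_ _ /asboolP[r ->] /asboolP[s ->]].
- by apply/asboolP; exists 1; rewrite rmorph1.
- by apply/asboolP; exists (r - s); rewrite rmorphB.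
- by apply/asboolP; exists (r * s); rewrite rmorphM.
Qed.

HB.instance Definition _ (R : comNzRingType) (hR : phi_ring R) :=
  GRing.isSubringClosed.Build (loc_nil hR) (in_phi_image hR)
    (in_phi_image_subring_closed hR).

Definition phi_image (R : comNzRingType) (hR : phi_ring R) : Type :=
  {y : loc_nil hR | y \in in_phi_image hR}.

HB.instance Definition _ (R : comNzRingType) (hR : phi_ring R) :=
  SubChoice.on (phi_image hR).
HB.instance Definition _ (R : comNzRingType) (hR : phi_ring R) :=
  GRing.SubChoice_isSubComPzRing.Build _ _ (phi_image hR)
    (in_phi_image_subring_closed hR).

Definition to_phi (R : comNzRingType) (hR : phi_ring R) (r : R) :
    phi_image hR :=
  exist _ (to_loc_nil hR r) (asboolT (ex_intro _ r erefl)).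

Definition phi_ideal (R : comNzRingType) (hR : phi_ring R)
    (I : submodClosed R^o) : {pred (phi_image hR)^o} :=
  fun y => `[< exists2 r, r \in I & y = to_phi hR r >].
Arguments phi_ideal {R} hR I _.

Lemma phi_ideal_submod_closed (R : comNzRingType) (hR : phi_ring R)
  (I : submodClosed R^o) : submod_closed (phi_ideal hR I).
Proof.
split=> [|c _ _ /asboolP[r rI ->] /asboolP[s sI ->]].
  apply/asboolP; exists 0; first exact: rpred0.
  by apply: val_inj; rewrite /= rmorph0.
have /asboolP[a ca] := valP c; apply/asboolP; exists (a * r + s).
  by apply: rpredD => //; exact: (rpredZ a rI).
by apply: val_inj; rewrite /= ca rmorphD rmorphM.
Qed.

HB.instance Definition _ (R : comNzRingType) (hR : phi_ring R)
    (I : submodClosed R^o) :=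
  GRing.isSubmodClosed.Build (phi_image hR) (phi_image hR)^o
    (phi_ideal hR I) (phi_ideal_submod_closed hR I).

Definition regular_ideal (A : comPzRingType) (J : submodClosed A^o) : Prop :=
  exists2 a, a \in J & a \in regular_elt A.

(* J^-1 = {x in T(A) : J x is contained in A} *)
Definition ideal_inv (A : comPzRingType) (J : submodClosed A^o) :
    {pred total_ring A} :=
  fun x => `[< forall a : A, a \in J ->
                 exists b : A, to_total A a * x = to_total A b >].
Arguments ideal_inv {A} J _.

(* The product J J^-1 in T(A) consists of the finite sums of products. *)
Definition ideal_mul_inv (A : comPzRingType) (J : submodClosed A^o) :
    {pred total_ring A} :=
  fun y => `[< exists2 s : seq (A * total_ring A),
                 all (fun p => (p.1 \in J) && (p.2 \in ideal_inv J)) s &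
                 y = \sum_(p <- s) to_total A p.1 * p.2 >].
Arguments ideal_mul_inv {A} J _.

Definition invertible (A : comPzRingType) (J : submodClosed A^o) : Prop :=
  regular_ideal J /\
  forall y : total_ring A,
    y \in ideal_mul_inv J <-> exists a : A, y = to_total A a.

Definition nonnil (R : comNzRingType) (I : submodClosed R^o) : Prop :=
  exists2 x, x \in I & x \notin nilradical R.

Definition phi_invertible (R : comNzRingType) (hR : phi_ring R)
    (I : submodClosed R^o) : Prop :=
  invertible (phi_ideal hR I).

Definition phi_Dedekind (R : comNzRingType) (hR : phi_ring R) : Prop :=
  forall I : submodClosed R^o, nonnil I -> phi_invertible hR I.

Definition ideal_module (R : pzRingType) (I : submodClosed R^o) : Type :=
  {x : R^o | x \in I}.

HB.instance Definition _ (R : pzRingType) (I : submodClosed R^o) :=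
  SubChoice.on (ideal_module I).
HB.instance Definition _ (R : pzRingType) (I : submodClosed R^o) :=
  [SubChoice_isSubLmodule of ideal_module I by <:].

Definition injective_module (R : pzRingType) (E : lmodType R) : Prop :=
  forall (A B : lmodType R) (i : {linear A -> B}) (f : {linear A -> E}),
    injective i -> exists g : {linear B -> E}, forall x, g (i x) = f x.

Definition projective_module (R : pzRingType) (P : lmodType R) : Prop :=
  forall (A B : lmodType R) (p : {linear A -> B}) (f : {linear P -> B}),
    (forall y, exists x, y = p x) ->
    exists g : {linear P -> A}, forall x, p (g x) = f x.

Definition divisible_module (R : pzRingType) (E : lmodType R) : Prop :=
  forall s, s \in regular_elt R -> forall x : E, exists y, x = s *: y.

Definition h_divisible_module (R : pzRingType) (M : lmodType R) : Prop :=
  exists2 E : lmodType R, injective_module E &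
    exists q : {linear E -> M}, forall y, exists x, y = q x.

Record projective_resolution (R : pzRingType) (T : lmodType R) := ProjRes {
  res_obj : nat -> lmodType R;
  res_diff : forall n, {linear res_obj n.+1 -> res_obj n};
  res_aug : {linear res_obj 0 -> T};
  res_projective : forall n, projective_module (res_obj n);
  res_aug_surj : forall y, exists x, y = res_aug x;
  res_exact0 : forall x, res_aug x = 0 <-> exists y, x = res_diff 0 y;
  res_exactS : forall n x,
    res_diff n x = 0 <-> exists y, x = res_diff n.+1 y
}.

(* Ext^1_R(T, M) = H^1(Hom_R(P, M)) for P a projective resolution of T; it    *)
(* vanishes when every 1-cocycle is a 1-coboundary.  Up to isomorphism the    *)
(* group does not depend on P, and free resolutions always exist.             *)
Definition Ext1_vanishes (R : comPzRingType) (T M : lmodType R) : Prop :=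
  forall (P : projective_resolution T) (f : {linear res_obj P 1 -> M}),
    (forall x, f (res_diff P 1 x) = 0) ->
    exists g : {linear res_obj P 0 -> M}, forall x, f x = g (res_diff P 0 x).

Definition phi_torsion (R : comNzRingType) (T : lmodType R) : Prop :=
  forall x : T, exists2 I : submodClosed R^o, nonnil I &
    forall a : R, a \in I -> a *: x = 0.

Definition nonnil_injective (R : comNzRingType) (M : lmodType R) : Prop :=
  forall T : lmodType R, phi_torsion T -> Ext1_vanishes T M.

(* Main.v *)
Require Import Defs.
From HB Require Import structures.
From mathcomp Require Import all_boot all_order all_algebra.
From mathcomp Require Import generic_quotient ring_quotient boolp ring.
From mathcomp Require Import classical_sets functions.
From mathcomp.multinomials Require Import freeg.

(* In a strong phi-ring R is phi(R), and a nonnil ideal I is invertible iff   *)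
(* there are a regular d, a_i in I and b_i in R with sum a_i b_i = d and      *)
(* d | a b_i for all a in I.                                                  *)
(* (1) => (2): if M is divisible and h : I -> M is linear, choose m_i with    *)
(* d m_i = h(a_i); then h is multiplication by sum b_i m_i.  Baer's argument  *)
(* extends this from ideals to all phi-torsion cokernels.                     *)
(* (2) => (3): injective modules are divisible, hence so are their quotients. *)
(* (3) => (4): lift f : I -> B along p : A -> B as follows.  Embed A in an    *)
(* injective E; then f followed by B = A / ker p -> E / ker p extends to R,   *)
(* by x |-> x e mod ker p, and x |-> x e maps I into A.                       *)
(* (4) => (1): if (x) is projective and x is not nilpotent, then x = x c with *)
(* c annihilated by ann(x) and 1 - c nilpotent, so x is regular.  The dual    *)
(* basis of a projective nonnil ideal then gives d, a_i and b_i.              *)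

Set Implicit Arguments.
Unset Strict Implicit.
Unset Printing Implicit Defensive.

Import GRing.Theory Num.Theory.

Local Open Scope ring_scope.
Local Open Scope quotient_scope.

(** * Linear maps defined on submodules *)

(** Everything rests on one elementary description of invertibility. Over a strong phi-ring the
    non-nilpotent elements are regular, so [R] is isomorphic to phi(R), and a nonnil ideal I is
    phi-invertible iff it admits the finite data of [dual_basis], that is, functionals a |-> a b_i /
    d on I dual to the a_i ([phi_invertible_dual_basis]). Such data turn a linear map from I to a
    divisible module into multiplication by one element ([phi_Dedekind_nonnil_injective]).
    Conversely, a section of a free cover of a projective ideal yields them
    ([projective_dual_basis]), and projectivity of principal ideals makes non-nilpotent elements
    regular ([projective_principal_regular]). Projectivity comes from (3) because a lifting problem
    along A -> B can be moved to E -> E/K with E injective, where maps from I extend to R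
    ([nonnil_projective]). The Zorn argument [linear_extension] serves twice: over the integers, to
    build enough injectives from divisible groups, and over [R], to extend cocycles. *)

Lemma linear_pack (R : pzRingType) (U V : lmodType R) (f : U -> V) :
  linear f -> exists g : {linear U -> V}, g =1 f.
Proof.
move=> flin; pose F := GRing.isLinear.Build R U V *:%R f flin.
pose g : {linear U -> V} := HB.pack f F.
by exists g.
Qed.

Lemma submod_pack (R : pzRingType) (V : lmodType R) (S : {pred V}) :
  submod_closed S -> exists K : submodClosed V, K =i S.
Proof.
move=> Scl; pose F := GRing.isSubmodClosed.Build R V S Scl.
pose K : submodClosed V := HB.pack S F.
by exists K.
Qed.

Section LinearGraph.
Variables (R : pzRingType) (Y M : lmodType R).

(** A partial linear map, as a submodule of [Y * M]. Single-valuedness is asked at 0 only;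
    differences reduce the general case to it. *)
Definition linear_graph (G : set (Y * M)) : Prop :=
  [/\ G 0, forall a p q, G p -> G q -> G (a *: p + q) &
      forall m, G (0, m) -> m = 0].

Lemma linear_graphZ G a p : linear_graph G -> G p -> G (a *: p).
Proof. by case=> G0 Gl _ Gp; rewrite -[_ *: p]addr0; apply: Gl. Qed.

Lemma linear_graph_uniq G y m n :
  linear_graph G -> G (y, m) -> G (y, n) -> m = n.
Proof.
case=> _ Gl Gf Gm Gn; apply/eqP; rewrite eq_sym -subr_eq0; apply/eqP/Gf.
have := Gl (-1) _ _ Gm Gn.
have -> : -1 *: (y, m) + (y, n) = (-1 *: y + y, -1 *: m + n) by [].
by rewrite !scaleN1r addNr addrC.
Qed.

(** Baer's argument: by Zorn's lemma it suffices to extend by one element x, and m is an admissible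
    value there when it agrees with what [G] already imposes on the multiples of x. *)
Lemma linear_extension (G0 : set (Y * M)) :
    linear_graph G0 ->
    (forall G, linear_graph G -> (G0 `<=` G)%classic ->
       forall x, exists m, forall r n, G (r *: x, n) -> n = r *: m) ->
  exists g : {linear Y -> M}, forall p, G0 p -> g p.1 = p.2.
Proof.
move=> G0lin step.
(* The union with [G0] makes the empty chain harmless: its union must satisfy [P] too. *)
pose P : set (set (Y * M)) := fun A => linear_graph (G0 `|` A)%classic.
have [F FP Ftot|A [PA Amax]] := @Zorn_bigcup _ P.
  set U := bigcup F id; rewrite /P.
  have dir p q : (G0 `|` U)%classic p -> (G0 `|` U)%classic q ->
      exists2 H : set (Y * M), linear_graph H &
        [/\ H p, H q & (H `<=` G0 `|` U)%classic].
    case=> [Gp|[B FB Bp]] [Gq|[C FC Cq]].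
    - by exists G0 => //; split=> // z; left.
    - by exists (G0 `|` C)%classic; [exact: FP|];
        split; [left|right|move=> z [|Cz]; [left|right; exists C]].
    - by exists (G0 `|` B)%classic; [exact: FP|];
        split; [right|left|move=> z [|Bz]; [left|right; exists B]].
    - have [BC|CB] := Ftot _ _ FB FC.
        by exists (G0 `|` C)%classic; [exact: FP|];
          split; [right; exact: BC|right|
                  move=> z [|Cz]; [left|right; exists C]].
      by exists (G0 `|` B)%classic; [exact: FP|];
        split; [right|right; exact: CB|move=> z [|Bz]; [left|right; exists B]].
  split.
  - by left; case: G0lin.
  - by move=> a p q /dir Up /Up[H [_ Hl _] [Hp Hq]]; apply; apply: Hl.
  - by move=> m Um; have [H [_ _ Hf] [Hm _ _]] := dir _ _ Um Um; apply: Hf.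
set G := (G0 `|` A)%classic in PA; have Glin : linear_graph G := PA.
have G0G : (G0 `<=` G)%classic by move=> z; left.
have total x : exists m, G (x, m).
  have [m mP] := step G Glin G0G x; exists m.
  pose G' : set (Y * M) := fun p => exists q r, G q /\ p = q + r *: (x, m).
  have GG' : (G `<=` G')%classic.
    by move=> q Gq; exists q, 0; rewrite scale0r addr0.
  have G'x : G' (x, m).
    by exists 0, 1; rewrite scale1r add0r; case: (Glin).
  have PG' : P G'.
    rewrite /P; have -> : (G0 `|` G')%classic = G'.
      by apply/seteqP; split=> [z [/G0G/GG'|]|z] //; right.
    have [Gz Gl Gf] := Glin; split; first exact/GG'.
      move=> a _ _ [p [r [Gp ->]]] [q [s [Gq ->]]].
      exists (a *: p + q), (a * r + s); split; first exact: Gl.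
      by rewrite scalerDr scalerA scalerDl addrACA.
    (* If (y, k) + r (x, m) lies over 0, then y = - r x, so [mP] forces k = - r m and the sum
       vanishes. *)
    move=> n [[y k] [r [Gq]]] /eqP; rewrite xpair_eqE.
    move=> /andP[/eqP /= y0 /eqP /= ->].
    have yE : y = - r *: x by apply/eqP; rewrite scaleNr -addr_eq0 -y0.
    by rewrite yE in Gq; rewrite (mP _ _ Gq) scaleNr addNr.
  have [AG'|] := EM (A = G'); first by right; rewrite AG'.
  move=> nAG'; exfalso; apply: (Amax G') => //; rewrite properEneq; split=> //.
    exact/eqP.
  by move=> z Az; apply: GG'; right.
have [g gG] := choice total.
have glin : linear g.
  move=> a u v; apply: (linear_graph_uniq Glin (gG _)).
  by have [_ Gl _] := Glin; apply: (Gl a (u, g u) (v, g v)).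
have [h hE] := linear_pack glin; exists h => -[y m] Gym /=.
by rewrite hE; exact: (linear_graph_uniq Glin (gG y) (G0G _ Gym)).
Qed.

End LinearGraph.

(** The integers r with r x in the domain form an ideal. If it is nonzero, its least positive
    element d generates it, and the value at d x, divided by d, serves at x. *)
Lemma divisible_int_extension (Y D : lmodType int) (G0 : set (Y * D)) :
    (forall (n : int) (x : D), n != 0 -> exists y, x = n *: y) ->
    linear_graph G0 ->
  exists g : {linear Y -> D}, forall p, G0 p -> g p.1 = p.2.
Proof.
move=> div G0lin; apply: linear_extension => // G Glin _ x.
pose I k := `[< exists n, G (k%:Z *: x, n) >] && (k != 0%N).
have [[k Ik]|noI] := EM (exists k, I k); last first.
  exists 0 => r n Grn; rewrite scaler0.
  have [r0|r0] := eqVneq r 0.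
    by case: Glin => _ _; apply; rewrite -[0](scale0r x) -r0.
  exfalso; apply: noI; exists `|r|%N; rewrite /I absz_eq0 r0 andbT.
  apply/asboolP; exists (Num.sg r *: n).
  rewrite -[Posz _]/`|r| normrEsg -scalerA.
  exact: (linear_graphZ _ Glin Grn).
have [d /andP[/asboolP[m Gm] d0] dmin] := ex_minnP (ex_intro _ k Ik).
have [m' mE] := div d%:Z m d0; exists m' => r n Grn.
have rem0 : (r %% d%:Z)%Z = 0.
  apply/eqP/negP => /negP rem_neq0.
  have Irem : I `|(r %% d%:Z)%Z|%N.
    rewrite /I absz_eq0 rem_neq0 andbT; apply/asboolP.
    exists (- (r %/ d%:Z)%Z *: m + n).
    have -> : `|(r %% d%:Z)%Z|%N%:Z = - (r %/ d%:Z)%Z * d%:Z + r.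
      rewrite gez0_abs ?modz_ge0 // {3}(divz_eq r d) addrA mulNr addNr.
      by rewrite add0r.
    rewrite scalerDl -scalerA.
    by have [_ Gl _] := Glin; apply: (Gl (- (r %/ d%:Z)%Z) _ _ Gm Grn).
  have := dmin _ Irem; rewrite leqNgt => /negP; apply.
  by rewrite -ltz_nat gez0_abs ?modz_ge0 ?ltz_pmod // ltz_nat lt0n.
have rE : r = (r %/ d%:Z)%Z * d by rewrite {1}(divz_eq r d) rem0 addr0.
apply: (linear_graph_uniq Glin Grn).
rewrite rE -!scalerA -mE.
exact: (linear_graphZ (r %/ d%:Z)%Z Glin Gm).
Qed.

(** * Quotients, free modules and resolutions *)

Section QuotientModule.
Variables (R : pzRingType) (V : lmodType R) (K : submodClosed V).

Definition submod_pred : {pred V} := fun x => x \in K.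
HB.instance Definition _ := GRing.isZmodClosed.Build V submod_pred
  (GRing.submod_closedB (GRing.submodClosedP K)).
Local Notation Q := (Quotient.quot submod_pred).

Definition quotient_module : Type := Q.
HB.instance Definition _ := GRing.Zmodule.on quotient_module.

Definition to_quotient (x : V) : quotient_module := \pi_Q x.

Lemma to_quotient_zmod_morphism : zmod_morphism to_quotient.
Proof. exact: (raddfB (\pi_Q)). Qed.

HB.instance Definition _ := GRing.isZmodMorphism.Build V quotient_module
  to_quotient to_quotient_zmod_morphism.

Lemma to_quotient_surj y : exists x, y = to_quotient x.
Proof. by exists (repr (y : Q)); rewrite /to_quotient reprK. Qed.

Lemma to_quotient_eq0 x : (to_quotient x = 0) <-> (x \in K).
Proof.
have -> : (x \in K) = (x - 0 \in submod_pred) by rewrite subr0.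
rewrite Quotient.idealrBE.
have -> : \pi_Q 0 = to_quotient 0 by [].
by rewrite raddf0; split=> [/eqP|/eqP].
Qed.

Definition quotient_scale (a : R) (y : quotient_module) : quotient_module :=
  to_quotient (a *: repr (y : Q)).

Lemma to_quotient_scale a x :
  to_quotient (a *: x) = quotient_scale a (to_quotient x).
Proof.
apply/eqP; rewrite -subr_eq0 -raddfB -scalerBr; apply/eqP/to_quotient_eq0.
apply: rpredZ; apply/to_quotient_eq0; rewrite raddfB /=.
by rewrite [to_quotient (repr _)]reprK subrr.
Qed.

Fact quotient_scaleA a b y :
  quotient_scale a (quotient_scale b y) = quotient_scale (a * b) y.
Proof.
by have [x ->] := to_quotient_surj y; rewrite -!to_quotient_scale scalerA.
Qed.

Fact quotient_scale1 : left_id 1 quotient_scale.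
Proof.
by move=> y; have [x ->] := to_quotient_surj y;
   rewrite -to_quotient_scale scale1r.
Qed.

Fact quotient_scaleDr : right_distributive quotient_scale +%R.
Proof.
move=> a y z; have [u ->] := to_quotient_surj y.
have [v ->] := to_quotient_surj z.
by rewrite -raddfD -!to_quotient_scale -raddfD scalerDr.
Qed.

Fact quotient_scaleDl y : {morph quotient_scale^~ y : a b / a + b}.
Proof.
move=> a b; have [u ->] := to_quotient_surj y.
by rewrite -!to_quotient_scale -raddfD scalerDl.
Qed.

HB.instance Definition _ := GRing.Zmodule_isLmodule.Build R quotient_module
  quotient_scaleA quotient_scale1 quotient_scaleDr quotient_scaleDl.

HB.instance Definition _ := GRing.isScalable.Build R V quotient_module *:%R
  to_quotient to_quotient_scale.

End QuotientModule.

Section Kernel.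
Variables (R : pzRingType) (U V : lmodType R) (f : {linear U -> V}).

Definition kernel : {pred U} := fun x => f x == 0.

Lemma kernel_submod_closed : submod_closed kernel.
Proof.
split=> [|a x y /eqP x0 /eqP y0]; first by rewrite /in_mem /= /kernel linear0.
by apply/eqP; rewrite linearP x0 y0 scaler0 addr0.
Qed.

HB.instance Definition _ :=
  GRing.isSubmodClosed.Build R U kernel kernel_submod_closed.

Definition kernel_module : Type := {x : U | x \in kernel}.
HB.instance Definition _ := SubChoice.on kernel_module.
HB.instance Definition _ := [SubChoice_isSubLmodule of kernel_module by <:].

Lemma kernel_module0 (x : kernel_module) : f (val x) = 0.
Proof. by apply/eqP; exact: (valP x). Qed.

End Kernel.

Section FreeModule.
Variables (R : nzRingType) (X : choiceType).

HB.instance Definition _ (M : lmodType R) (h : X -> M) :=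
  GRing.isZmodMorphism.Build {freeg X / R} M (fglift h) (lift_is_additive h).

Lemma fglift_scalable (M : lmodType R) (h : X -> M) : scalable (fglift h).
Proof.
move=> a D; have -> : a *: D = \sum_(x <- dom D) << a * coeff x D *g x >> by [].
rewrite -[in RHS](freeg_sumE D) !raddf_sum /=.
by apply: eq_bigr => x _ /=; rewrite !liftU scalerA.
Qed.

HB.instance Definition _ (M : lmodType R) (h : X -> M) :=
  GRing.isScalable.Build R {freeg X / R} M *:%R (fglift h) (fglift_scalable h).

Lemma freeg_projective : projective_module {freeg X / R}.
Proof.
move=> A B p f psurj; have [s sP] := choice (fun x : X => psurj (f << x >>)).
exists (fglift s) => D; rewrite -[D]freeg_sumE !linear_sum /=.
apply: eq_bigr => x _.
have -> : << coeff x D *g x >> = coeff x D *: << x >> :> {freeg X / R}.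
  by apply/eqP/freeg_eqP=> y; rewrite coeffZ !coeffU mul1r.
by rewrite !linearZ /= liftU scale1r sP.
Qed.

End FreeModule.

Lemma free_cover_surj (R : nzRingType) (M : lmodType R) (x : M) :
  exists D : {freeg M / R}, x = fglift id D.
Proof. by exists << x >>; rewrite liftU scale1r. Qed.

Lemma regular_module_projective (R : nzRingType) : projective_module R^o.
Proof.
move=> A B p f psurj; have [a aE] := psurj (f 1).
have lin : linear (fun r : R^o => r *: a).
  by move=> c r s /=; rewrite scalerDl scalerA.
have [g gE] := linear_pack lin.
by exists g => r; rewrite gE linearZ -aE -linearZ /= [_ *: _]mulr1.
Qed.

Section Resolution.
Variable R : nzRingType.

(** Bundling source and target lets [iter] change modules at each step. The codomain of
    [kernel_cover a] computes to the domain of [a], so successive iterates compose. *)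
Record arrow := Arrow {
  arrow_dom : lmodType R;
  arrow_cod : lmodType R;
  arrow_map : {linear arrow_dom -> arrow_cod}
}.

Definition kernel_cover_fun (a : arrow)
    (D : {freeg (kernel_module (arrow_map a)) / R}) : arrow_dom a :=
  val (fglift id D).

Lemma kernel_cover_linear a : linear (@kernel_cover_fun a).
Proof. by move=> c D E; rewrite /kernel_cover_fun !linearP. Qed.

HB.instance Definition _ a := GRing.isLinear.Build R _ _ *:%R
  (@kernel_cover_fun a) (@kernel_cover_linear a).

Definition kernel_cover (a : arrow) : arrow :=
  Arrow (@kernel_cover_fun a).

Lemma kernel_cover_exact a x :
  arrow_map a x = 0 <-> exists y, x = arrow_map (kernel_cover a) y.
Proof.
split=> [x0|[y ->]]; last exact: kernel_module0.
have kx : x \in kernel (arrow_map a) by apply/eqP.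
have [D DE] := free_cover_surj (exist _ x kx : kernel_module (arrow_map a)).
by exists D; rewrite /= /kernel_cover_fun -DE.
Qed.

Definition resolution_step (P T : lmodType R) (e : {linear P -> T}) n :=
  iter n kernel_cover (Arrow e).

(** Kept transparent, so that the module in degree 0 computes to the given [P]; it will have to be
    [R^o] itself. *)
Definition free_resolution (P T : lmodType R) (e : {linear P -> T})
    (Pproj : projective_module P) (esurj : forall y, exists x, y = e x) :
  projective_resolution T.
Proof.
refine (@ProjRes R T (fun n => arrow_dom (resolution_step e n))
  (fun n => arrow_map (resolution_step e n.+1)) e _ esurj _ _).
- by case=> [|n] //; apply: freeg_projective.
- move=> x; refine (@kernel_cover_exact (Arrow e) x).
- by move=> n x; refine (@kernel_cover_exact (resolution_step e n.+1) x).
Defined.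

End Resolution.

(** * Enough injective modules *)

Section DivisibleHull.
Variable A : zmodType.

Let int_sum (z : {freeg A / int}) : zmodule A := fglift (id : A -> zmodule A) z.

(* The divisible hull is Q^(A) modulo the relations holding in Z^(A) -> A. *)
Definition hull_rel : {pred {freeg A / rat}} := fun q =>
  `[< exists2 z : {freeg A / int}, int_sum z = 0 &
        forall a, coeff a q = (coeff a z)%:~R >].

Lemma hull_rel_zmod_closed : zmod_closed hull_rel.
Proof.
split.
  by apply/asboolP; exists 0 => [|a]; rewrite ?coeff0 // /int_sum raddf0.
move=> p q /asboolP[y y0 yE] /asboolP[z z0 zE]; apply/asboolP.
exists (y - z) => [|a]; last by rewrite !coeffB rmorphB yE zE.
by move: y0 z0; rewrite /int_sum raddfB /= => -> ->; rewrite subr0.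
Qed.

HB.instance Definition _ := GRing.isZmodClosed.Build {freeg A / rat} hull_rel
  hull_rel_zmod_closed.

Definition divisible_hull : zmodType := Quotient.quot hull_rel.

Definition to_hull (a : A) : divisible_hull :=
  \pi_(Quotient.quot hull_rel) << a >>.

Lemma hull_pi_eq0 q : \pi_(Quotient.quot hull_rel) q = 0 <-> q \in hull_rel.
Proof.
have -> : 0 = \pi_(Quotient.quot hull_rel) 0 by rewrite raddf0.
have -> : (q \in hull_rel) = (q - 0 \in hull_rel) by rewrite subr0.
by rewrite Quotient.idealrBE; split=> [/eqP|/eqP].
Qed.

Lemma to_hull_zmod_morphism : zmod_morphism to_hull.
Proof.
move=> a b; apply/eqP; rewrite -subr_eq0 /to_hull -!raddfB.
apply/eqP/hull_pi_eq0.
apply/asboolP; exists (<< a - b >> - (<< a >> - << b >>)).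
  rewrite /int_sum raddfB [X in _ - X]raddfB /= !liftU !scale1r; exact: subrr.
by move=> c; rewrite !coeffB !coeffU !mul1r !rmorphB /= !rmorph_nat.
Qed.

HB.instance Definition _ := GRing.isZmodMorphism.Build A divisible_hull
  to_hull to_hull_zmod_morphism.

(** If the generator of a lies in [hull_rel], its integral witness has the same coefficients, hence
    is that generator too, and its sum in [A] is both a and 0. *)
Lemma to_hull_inj : injective to_hull.
Proof.
apply: raddf_inj => a /hull_pi_eq0 /asboolP[z z0 zE].
have zU : z = << a >>.
  apply/eqP/freeg_eqP => b; apply: (@intr_inj rat).
  by rewrite -zE !coeffU !mul1r rmorph_nat.
by move: z0; rewrite zU /int_sum liftU scale1r.
Qed.

Lemma divisible_hullP (n : int) (x : zmodule divisible_hull) :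
  n != 0 -> exists y, x = n *: y.
Proof.
move=> n0; pose q := repr (x : Quotient.quot hull_rel).
exists (\pi_(Quotient.quot hull_rel) ((n%:~R : rat)^-1 *: q)).
rewrite scalezrE -raddfMz -scaler_int scalerA mulfV ?intr_eq0 // scale1r.
exact: (esym (reprK (x : Quotient.quot (hull_rel)))).
Qed.

End DivisibleHull.

Section Coinduced.
Variables (R : pzRingType) (D : zmodType).

Definition additive_pred : {pred R -> D} := fun f => `[< zmod_morphism f >].

Lemma additive_predP f : reflect (zmod_morphism f) (f \in additive_pred).
Proof. exact: asboolP. Qed.

Lemma additive_pred_zmod_closed : zmod_closed additive_pred.
Proof.
split=> [|f g /additive_predP fA /additive_predP gA];
  apply/additive_predP => a b.
  by rewrite /GRing.zero /= subrr.
have E (h k : R -> D) x : (h - k) x = h x - k x by [].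
by rewrite !E fA gA !opprD !opprK addrACA.
Qed.

HB.instance Definition _ := GRing.isZmodClosed.Build (R -> D) additive_pred
  additive_pred_zmod_closed.

(** This is Hom_Z(R, D), with the action (a f)(x) = f(x a). *)
Definition coinduced : Type := {f : R -> D | f \in additive_pred}.
HB.instance Definition _ := SubChoice.on coinduced.
HB.instance Definition _ := [SubChoice_isSubZmodule of coinduced by <:].

Lemma coinducedB (f : coinduced) a b : val f (a - b) = val f a - val f b.
Proof. exact: (additive_predP _ (valP f)). Qed.

Lemma coinducedD (f : coinduced) a b : val f (a + b) = val f a + val f b.
Proof.
have f0 : val f 0 = 0 by rewrite -[0 in LHS](subrr 0) coinducedB subrr.
by rewrite -[b in LHS]opprK -[- b]sub0r !coinducedB f0 sub0r opprK.
Qed.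

Lemma coinduced_ext (f g : coinduced) : val f =1 val g -> f = g.
Proof. by move=> fg; apply: val_inj; apply: funext. Qed.

Lemma coinduced_scale_subproof (a : R) (f : coinduced) :
  (fun x => val f (x * a)) \in additive_pred.
Proof. by apply/additive_predP => x y; rewrite mulrBl coinducedB. Qed.

Definition coinduced_scale a f : coinduced :=
  Sub (fun x => val f (x * a)) (coinduced_scale_subproof a f).

Fact coinduced_scaleA a b f :
  coinduced_scale a (coinduced_scale b f) = coinduced_scale (a * b) f.
Proof. by apply: coinduced_ext => x /=; rewrite mulrA. Qed.

Fact coinduced_scale1 : left_id 1 coinduced_scale.
Proof. by move=> f; apply: coinduced_ext => x /=; rewrite mulr1. Qed.

Fact coinduced_scaleDr : right_distributive coinduced_scale +%R.
Proof. by move=> a f g; apply: coinduced_ext. Qed.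

Fact coinduced_scaleDl f : {morph coinduced_scale^~ f : a b / a + b}.
Proof.
by move=> a b; apply: coinduced_ext => x; rewrite /= mulrDr; exact: coinducedD.
Qed.

HB.instance Definition _ := GRing.Zmodule_isLmodule.Build R coinduced
  coinduced_scaleA coinduced_scale1 coinduced_scaleDr coinduced_scaleDl.

Lemma coinducedE a (f g : coinduced) x :
  val (a *: f + g) x = val f (x * a) + val g x.
Proof. by []. Qed.

Definition coinduced_eval (f : coinduced) : zmodule D := val f 1.

Lemma coinduced_eval_zmod_morphism : zmod_morphism coinduced_eval.
Proof. by []. Qed.

HB.instance Definition _ := GRing.isZmodMorphism.Build coinduced (zmodule D)
  coinduced_eval coinduced_eval_zmod_morphism.

(** Hom_Z(R, -) is right adjoint to forgetting the action of [R]. Evaluation at 1 turns f into an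
    additive map X -> D, which extends to g on Y because [D] is divisible; y |-> (r |-> g(r y))
    transposes it back. *)
Lemma coinduced_injective :
    (forall (n : int) (x : zmodule D), n != 0 -> exists y, x = n *: y) ->
  injective_module coinduced.
Proof.
move=> Ddiv X Y i f iinj.
pose G0 : set (zmodule Y * zmodule D) :=
  fun p => exists x, p = (i x, coinduced_eval (f x)).
have G0lin : linear_graph G0.
  split.
  - by exists 0; rewrite !linear0 raddf0.
  - move=> n _ _ [x ->] [y ->]; exists (x *~ n + y).
    by congr pair; rewrite !raddfD !raddfMz.
  - move=> m [x []] /esym; rewrite -(linear0 i) => /iinj -> ->.
    by rewrite linear0 raddf0.
have [g gE] := divisible_int_extension Ddiv G0lin.
pose h (y : Y) : R -> D := fun r => g (r *: y).
have hA y : h y \in additive_pred.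
  by apply/additive_predP => a b; rewrite /h scalerBl (raddfB g).
have hlin : linear (fun y => Sub (h y) (hA y) : coinduced).
  move=> a y z; apply: coinduced_ext => r; rewrite coinducedE /= /h.
  by rewrite scalerDr scalerA (raddfD g).
have [k kE] := linear_pack hlin; exists k => x; rewrite kE.
apply: coinduced_ext => r /=; rewrite /h -linearZ.
rewrite (gE (i (r *: x), coinduced_eval (f (r *: x)))) /=;
  last by exists (r *: x).
by rewrite linearZ /coinduced_eval /= mul1r.
Qed.

End Coinduced.

Section InjectiveEmbedding.
Variables (R : pzRingType) (A : lmodType R).

Lemma injective_embedding :
  exists2 E : lmodType R, injective_module E &
    exists j : {linear A -> E}, injective j.
Proof.
exists (coinduced R (divisible_hull A)).
  exact/coinduced_injective/divisible_hullP.
have jA (a : A) : (fun r : R => to_hull (r *: a)) \in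
    @additive_pred R (divisible_hull A).
  by apply/additive_predP => r s; rewrite scalerBl raddfB.
have jlin : linear (fun a =>
    Sub (fun r : R => to_hull (r *: a)) (jA a)
      : coinduced R (divisible_hull A)).
  move=> c a b; apply: coinduced_ext => r; rewrite coinducedE /=.
  by rewrite scalerDr scalerA raddfD.
have [j jE] := linear_pack jlin; exists j => a b; rewrite !jE.
move=> /(congr1 (fun f => val f 1)) /=; rewrite !scale1r.
exact: to_hull_inj.
Qed.

End InjectiveEmbedding.

(** * Invertible ideals *)

Lemma regular_eltP (A : pzRingType) (x : A) :
  reflect (forall y, x * y = 0 -> y = 0) (x \in regular_elt A).
Proof.
apply: (iffP idP) => [xreg y xy0 | xreg].
  by apply/eqP; apply: contraNT xreg => y0; apply/asboolP; exists y.
by apply/asboolPn => -[y /eqP y0 /xreg].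
Qed.

Lemma regular_eltI (A : pzRingType) (d x y : A) :
  d \in regular_elt A -> d * x = d * y -> x = y.
Proof.
move=> /regular_eltP dreg e; apply/eqP; rewrite -subr_eq0; apply/eqP/dreg.
by rewrite mulrBr e subrr.
Qed.

Section LocalizationMaps.
Variables (A : comPzRingType) (S : mulrClosed A).

Lemma loc_inj_eq (a b : A) :
  loc_inj S a = loc_inj S b <-> exists2 u, u \in S & u * a = u * b.
Proof.
split=> [/eqmodP/asboolP[u uS]|[u uS e]].
  by rewrite /loc_num /loc_den /= !mulr1; exists u.
by apply/eqmodP/asboolP; exists u => //; rewrite /loc_num /loc_den /= !mulr1.
Qed.

Lemma loc_injM_fraction a s (sS : s \in S) :
  loc_inj S s * \pi_(loc S) (loc_mk a sS) = loc_inj S a.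
Proof.
rewrite -[_ * _]/(loc_mul _ _) -loc_pi_mul; apply: loc_eq.
by rewrite /loc_mulf /loc_num /loc_den /=; ring.
Qed.

Lemma loc_fractionP (x : loc S) :
  exists a s, s \in S /\ loc_inj S s * x = loc_inj S a.
Proof.
elim/quotW: x => -[a [s sS]]; exists a, s; split=> //.
exact: loc_injM_fraction.
Qed.

Lemma loc_injI d x y : d \in S -> loc_inj S d * x = loc_inj S d * y -> x = y.
Proof.
move=> dS e; have := loc_injM_fraction 1 dS; set v := \pi__ _; rewrite rmorph1.
by move=> dv; rewrite -[x]mul1r -[y]mul1r -dv mulrAC e mulrAC.
Qed.

Lemma loc_common_denominator (X : eqType) (f : X -> loc S) (s : seq X) :
  exists2 d, d \in S &
    forall x, x \in s -> exists b, loc_inj S d * f x = loc_inj S b.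
Proof.
elim: s => [|x s [d dS IHs]]; first by exists 1 => //; exact: rpred1.
have [a [e [eS eE]]] := loc_fractionP (f x).
exists (d * e) => [|y]; first exact: rpredM.
rewrite inE => /predU1P[->|/IHs[b bE]].
  by exists (d * a); rewrite rmorphM -mulrA eE rmorphM.
by exists (e * b); rewrite rmorphM mulrAC bE -rmorphM mulrC.
Qed.

End LocalizationMaps.

Lemma to_total_inj (A : comPzRingType) : injective (to_total A).
Proof. by move=> a b /loc_inj_eq[u]; apply: regular_eltI. Qed.

Lemma to_totalI (A : comPzRingType) (d : A) x y :
  d \in regular_elt A -> to_total A d * x = to_total A d * y -> x = y.
Proof. exact: loc_injI. Qed.

(* The pairs (a, b) in s stand for the a_i in J and b_i / d in J^-1 of a      *)
(* relation sum a_i (b_i / d) = 1, with denominators cleared.                 *)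
Definition dual_basis (A : comPzRingType) (J : {pred A}) (d : A)
    (s : seq (A * A)) : Prop :=
  [/\ d \in regular_elt A, forall p, p \in s -> p.1 \in J,
      \sum_(p <- s) p.1 * p.2 = d &
      forall a p, a \in J -> p \in s -> exists c, a * p.2 = d * c].
Arguments dual_basis A J d s : clear implicits.

(** Forward, a relation 1 = sum a_i x_i in T(A) is multiplied by a common regular denominator of the
    x_i. Backward, x_i = b_i / d lies in J^-1, and any a in [A] equals sum (a a_i) x_i. *)
Lemma invertible_dual_basis (A : comPzRingType) (J : submodClosed A^o) :
  invertible J <-> regular_ideal J /\ exists d s, dual_basis A J d s.
Proof.
split=> -[Jreg Jinv]; split=> //.
  have /Jinv/asboolP[s sJ sE] : exists a, 1 = to_total A a
    by exists 1; rewrite rmorph1.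
  have [d dreg dP] := loc_common_denominator snd s.
  have {dP} bP (p : A * total_ring A) :
      exists b, p \in s -> to_total A d * p.2 = to_total A b.
    by have [/dP[b]|_] := boolP (p \in s); [exists b|exists 0].
  have [b bE] := choice bP.
  exists d, [seq (p.1, b p) | p <- s]; split=> //.
  - by move=> _ /mapP[p /(allP sJ)/andP[pJ _] ->].
  - rewrite big_map /=; apply: to_total_inj.
    rewrite -[RHS]mulr1 sE rmorph_sum mulr_sumr; apply: eq_big_seq => p ps /=.
    by rewrite rmorphM -bE // mulrCA.
  - move=> a _ aJ /mapP[p ps ->] /=.
    have /andP[_ /asboolP/(_ a aJ)[c cE]] := allP sJ p ps.
    exists c; apply: to_total_inj.
    by rewrite !rmorphM -bE // mulrCA cE.
have [d [s [dreg sJ sE sd]]] := Jinv => y; split.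
  move=> /asboolP[t tJ ->].
  elim: t tJ => [|p t IHt] /=; first by exists 0; rewrite big_nil rmorph0.
  case/andP=> /andP[pJ /asboolP/(_ _ pJ)[b bE]] /IHt[a aE].
  by exists (b + a); rewrite big_cons bE aE rmorphD.
case=> a ->; pose frac b : total_ring A :=
  \pi_(loc (regular_elt A)) (loc_mk b dreg).
have fracE b : to_total A d * frac b = to_total A b by exact: loc_injM_fraction.
apply/asboolP; exists [seq (a * p.1, frac p.2) | p <- s].
  apply/allP => _ /mapP[p ps ->] /=; apply/andP; split.
    exact: (rpredZ a (sJ _ ps)).
  apply/asboolP => x xJ; have [c cE] := sd x p xJ ps; exists c.
  by apply: (to_totalI dreg); rewrite mulrCA fracE -!rmorphM cE.
rewrite big_map; apply: (to_totalI dreg) => /=.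
rewrite mulr_sumr -rmorphM -[d in LHS]sE mulr_suml rmorph_sum.
apply: eq_bigr => p _ /=.
by rewrite mulrCA fracE -rmorphM; congr (to_total A _); ring.
Qed.

(** * Strong phi-rings: identifying R with phi(R) *)

Section NonnilElements.
Variables (R : comNzRingType) (hR : phi_ring R).

Lemma nilradical_zero_divisor (x : R) :
  x \in nilradical R -> x \in zero_divisor R.
Proof.
move=> /asboolP[n]; elim: n => [|n IHn] xn0.
  by move/eqP: xn0; rewrite expr0 oner_eq0.
have [/IHn//|xn] := eqVneq (x ^+ n) 0.
by apply/asboolP; exists (x ^+ n) => //; rewrite -exprS.
Qed.

Lemma strong_phi_ringP :
  strong_phi_ring R <-> forall x, x \notin nilradical R -> x \in regular_elt R.
Proof.
split=> [[_ ZN] x xN|reg]; first by rewrite -ZN in xN.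
split=> // x; apply/idP/idP => [xZ|/nilradical_zero_divisor//].
by apply: contraTT xZ => /reg.
Qed.

Hypothesis Rstrong : strong_phi_ring R.

(** The denominators are the non-nilpotent elements, here regular, so the localization kills
    nothing. *)
Lemma to_phi_inj : injective (to_phi hR).
Proof.
move=> a b /(congr1 val) /loc_inj_eq[u uS]; apply: regular_eltI.
exact: (proj1 strong_phi_ringP Rstrong).
Qed.

Lemma to_phiD a b : to_phi hR (a + b) = to_phi hR a + to_phi hR b.
Proof. by apply: val_inj; rewrite /= rmorphD. Qed.

Lemma to_phiM a b : to_phi hR (a * b) = to_phi hR a * to_phi hR b.
Proof. by apply: val_inj; rewrite /= rmorphM. Qed.

Lemma to_phi0 : to_phi hR 0 = 0.
Proof. by apply: val_inj; rewrite /= rmorph0. Qed.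

Lemma to_phi_sum (X : Type) (s : seq X) (F : X -> R) :
  to_phi hR (\sum_(x <- s) F x) = \sum_(x <- s) to_phi hR (F x).
Proof. by apply: (big_morph (to_phi hR) to_phiD to_phi0). Qed.

Lemma to_phi_surj y : exists r, y = to_phi hR r.
Proof. by have /asboolP[r rE] := valP y; exists r; apply: val_inj. Qed.

Lemma to_phi_regular r :
  (to_phi hR r \in regular_elt (phi_image hR)) = (r \in regular_elt R).
Proof.
apply/regular_eltP/regular_eltP => reg y.
  move=> ry0; apply: to_phi_inj; rewrite to_phi0; apply: reg.
  by rewrite -to_phiM ry0 to_phi0.
have [s ->] := to_phi_surj y; rewrite -to_phiM -to_phi0 => /to_phi_inj /reg ->.
by [].
Qed.

Lemma phi_idealE (I : submodClosed R^o) r :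
  (to_phi hR r \in phi_ideal hR I) = (r \in I).
Proof. by apply/asboolP/idP => [[s sI /to_phi_inj->]|rI] //; exists r. Qed.

Lemma phi_ideal_dual_basis (I : submodClosed R^o) :
  (exists d s, dual_basis (phi_image hR) (phi_ideal hR I) d s) <->
  (exists d s, dual_basis R I d s).
Proof.
split=> -[d [s [dreg sI sE sd]]].
  have [g gE] := choice to_phi_surj.
  exists (g d), [seq (g p.1, g p.2) | p <- s]; split.
  - by rewrite -to_phi_regular -gE.
  - by move=> _ /mapP[p ps ->] /=; rewrite -phi_idealE -gE; apply: sI.
  - apply: to_phi_inj; rewrite big_map to_phi_sum -gE -sE.
    by apply: eq_bigr => p _; rewrite to_phiM -!gE.
  - move=> a _ aI /mapP[p ps ->] /=.
    have [c cE] := sd (to_phi hR a) p (etrans (phi_idealE _ _) aI) ps.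
    by exists (g c); apply: to_phi_inj; rewrite !to_phiM -!gE.
exists (to_phi hR d), [seq (to_phi hR p.1, to_phi hR p.2) | p <- s]; split.
- by rewrite to_phi_regular.
- by move=> _ /mapP[p ps ->] /=; rewrite phi_idealE; apply: sI.
- by rewrite big_map -sE to_phi_sum; apply: eq_bigr => p _; rewrite to_phiM.
- move=> y _ yI /mapP[p ps ->] /=; have [a aE] := to_phi_surj y.
  rewrite aE phi_idealE in yI; have [c cE] := sd a p yI ps.
  by exists (to_phi hR c); rewrite aE -!to_phiM cE.
Qed.

(** The regularity demanded by invertibility is supplied by any non-nilpotent element of [I]. *)
Lemma phi_invertible_dual_basis (I : submodClosed R^o) :
  nonnil I -> phi_invertible hR I <-> exists d s, dual_basis R I d s.
Proof.
case=> x xI xN; rewrite -phi_ideal_dual_basis.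
split=> [/invertible_dual_basis[]//|db].
apply/invertible_dual_basis; split=> //.
exists (to_phi hR x); first by rewrite phi_idealE.
by rewrite to_phi_regular; apply: (proj1 strong_phi_ringP Rstrong).
Qed.

End NonnilElements.

(** * The equivalence *)

Section NonnilIdeals.
Variables (R : comNzRingType) (hR : phi_ring R).

(** A cocycle kills the kernel of P_1 -> P_0, so it is a partial linear map defined on the
    boundaries in P_0; extending it to P_0 makes it a coboundary. For each x in P_0, the ideal of
    all r with r x in the current domain is nonnil because [T] is phi-torsion. *)
Lemma phi_Dedekind_nonnil_injective :
    phi_Dedekind hR -> strong_phi_ring R ->
  forall M : lmodType R, divisible_module M -> nonnil_injective M.
Proof.
move=> Ded Rstrong M Mdiv T Ttor P f fd.
pose G0 : set (res_obj P 0 * M) := fun p => exists x, p = (res_diff P 0 x, f x).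
have G0lin : linear_graph G0.
  split.
  - by exists 0; rewrite !linear0.
  - by move=> a _ _ [x ->] [y ->]; exists (a *: x + y); rewrite !linearP.
  - by move=> m [x [/esym /res_exactS[y ->] ->]].
suff step G : linear_graph G -> (G0 `<=` G)%classic ->
    forall x, exists m, forall r n, G (r *: x, n) -> n = r *: m.
  have [g gE] := linear_extension G0lin step; exists g => x.
  by rewrite (gE (res_diff P 0 x, f x)) //; exists x.
move=> Glin G0G x.
pose dI : {pred R^o} := fun r => `[< exists n, G (r *: x, n) >].
have dI_closed : submod_closed dI.
  have [Gz Gl _] := Glin.
  split=> [|a r t /asboolP[m Gm] /asboolP[n Gn]]; apply/asboolP.
    by exists 0; rewrite scale0r.
  by exists (a *: m + n); rewrite scalerDl -scalerA; apply: Gl Gm Gn.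
have [I IE] := submod_pack dI_closed.
have Inonnil : nonnil I.
  have [J [b bJ bN] JT] := Ttor (res_aug P x).
  exists b => //; rewrite IE; apply/asboolP.
  have /res_exact0[y yE] : res_aug P (b *: x) = 0 by rewrite linearZ /= JT.
  by exists (f y); apply: G0G; exists y; rewrite yE.
have /(phi_invertible_dual_basis hR Rstrong Inonnil)[d [s [dreg sI sE sd]]] :=
  Ded I Inonnil.
have hP r : exists n, r \in I -> G (r *: x, n).
  have [|_] := boolP (r \in I); last by exists 0.
  by rewrite IE => /asboolP[n Gn]; exists n.
have [h hG] := choice hP.
(* Here d k(a_i, b_i) = h(a_i), by divisibility of [M]; the value at x will be sum b_i k(a_i,
   b_i). *)
have [k kE] := choice (fun p : R * R => Mdiv d dreg (h p.1)).
exists (\sum_(p <- s) p.2 *: k p) => r n Grn.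
have rI : r \in I by rewrite IE; apply/asboolP; exists n.
have [c cE] : exists c : R * R -> R, forall p, p \in s -> r * p.2 = d * c p.
  have cP p : exists c, p \in s -> r * p.2 = d * c.
    have [/(sd r p rI)[c]|_] := boolP (p \in s); last by exists 0.
    by exists c.
  by have [c] := choice cP; exists c.
(* From d = sum a_i b_i and r b_i = d c_i, cancel d. The value at r x is then sum c_i h(a_i) = sum
   c_i d k(a_i, b_i) = r sum b_i k(a_i, b_i). *)
have rE : r = \sum_(p <- s) c p * p.1.
  apply: (regular_eltI dreg); rewrite mulr_sumr -[d in LHS]sE mulr_suml.
  by apply: eq_big_seq => p ps; rewrite mulrA -cE //; ring.
have G_sum t (F : R * R -> R) : {subset t <= s} ->
    G ((\sum_(p <- t) F p * p.1) *: x, \sum_(p <- t) F p *: h p.1).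
  have [Gz Gl _] := Glin.
  elim: t => [|p t IHt] ts; first by rewrite !big_nil scale0r.
  rewrite !big_cons scalerDl -scalerA.
  apply: (Gl (F p) (p.1 *: x, h p.1) (_, _)).
    by apply/hG/sI/ts; rewrite inE eqxx.
  by apply: IHt => q qt; apply: ts; rewrite inE qt orbT.
rewrite (linear_graph_uniq Glin Grn (n := \sum_(p <- s) c p *: h p.1)).
  rewrite scaler_sumr; apply: eq_big_seq => p ps.
  by rewrite kE !scalerA cE // mulrC.
by rewrite [in X in G (X, _)]rE; apply: G_sum.
Qed.

(** Extend r |-> r x along multiplication by s on [R], which is injective; the image of 1 is the
    required quotient. *)
Lemma injective_divisible (E : lmodType R) :
  injective_module E -> divisible_module E.
Proof.
move=> Einj s sreg x.
have slin : linear (fun r : R^o => (s * r : R^o)).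
  by move=> a r t; rewrite mulrDr; congr (_ + _); exact: mulrCA.
have xlin : linear (fun r : R^o => r *: x).
  by move=> a r t; rewrite scalerDl -scalerA.
have [i iE] := linear_pack slin; have [f fE] := linear_pack xlin.
have iinj : injective i by move=> r t; rewrite !iE; apply: regular_eltI.
have [g gE] := Einj _ _ i f iinj; exists (g 1).
have := gE 1; rewrite fE scale1r => <-.
by rewrite -linearZ iE.
Qed.

Lemma h_divisible_divisible (M : lmodType R) :
  h_divisible_module M -> divisible_module M.
Proof.
case=> E /injective_divisible Ediv [q qsurj] s sreg x.
have [e ->] := qsurj x; have [e' ->] := Ediv s sreg e.
by exists (q e'); rewrite linearZ.
Qed.

(** R/I is phi-torsion, so Ext^1(R/I, M) vanishes. In a resolution starting with R -> R/I the first
    differential has image I; [h] composed with it is a cocycle, and a map g on [R] bounding it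
    extends [h], with m = g(1). *)
Lemma nonnil_injective_extends (M : lmodType R) (I : submodClosed R^o)
    (h : {linear ideal_module I -> M}) :
  nonnil_injective M -> nonnil I -> exists m, forall a, h a = val a *: m.
Proof.
move=> Minj Inonnil; pose T : lmodType R := quotient_module I.
have Ttor : phi_torsion T.
  move=> y; exists I => // a aI; have [x ->] := to_quotient_surj y.
  rewrite -linearZ; apply/to_quotient_eq0; rewrite /= [_ *: _]mulrC.
  exact: (rpredZ x aI).
pose e : {linear R^o -> T} := to_quotient I.
have esurj y : exists x, y = e x by exact: to_quotient_surj.
pose P := free_resolution (@regular_module_projective R) esurj.
have dI x : res_diff P 0 x \in I.
  have : res_aug P (res_diff P 0 x) = 0 by apply/res_exact0; exists x.
  exact: (proj1 (to_quotient_eq0 I _)).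
have flin : linear (fun x => h (Sub (res_diff P 0 x) (dI x) : ideal_module I)).
  move=> a x y; rewrite -linearP; congr (h _); apply: val_inj.
  by rewrite /= linearP.
have [f fE] := linear_pack flin.
have [|g gE] := Minj T Ttor P f.
  move=> x; rewrite fE -(linear0 h); congr (h _); apply: val_inj => /=.
  exact: (proj2 (@res_exactS _ _ P 0 _) (ex_intro _ x erefl)).
exists (g (1 : R^o)) => a.
have /res_exact0[y yE] : res_aug P (val a : R^o) = 0.
  by apply/to_quotient_eq0; exact: (valP a).
rewrite -linearZ /= [_ *: 1]mulr1.
rewrite [val a]yE -gE fE.
by congr (h _); apply: val_inj.
Qed.

Lemma nonnil_projective (I : submodClosed R^o) :
    (forall M : lmodType R, h_divisible_module M -> nonnil_injective M) ->
    nonnil I ->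
  projective_module (ideal_module I).
Proof.
move=> hdiv Inonnil A B p f psurj.
have [E Einj [j jinj]] := injective_embedding A.
pose S : {pred E} := fun e => `[< exists2 a, p a = 0 & e = j a >].
have Scl : submod_closed S.
  split=> [|c _ _ /asboolP[a a0 ->] /asboolP[b b0 ->]]; apply/asboolP.
    by exists 0; rewrite linear0.
  by exists (c *: a + b); rewrite linearP // a0 b0 scaler0 addr0.
have [K KE] := submod_pack Scl.
have [s sP] := choice psurj.
(* The section [s] is only set-theoretic; its defect of linearity lies in ker p and disappears
   modulo K = j(ker p). *)
have hlin : linear (fun x : ideal_module I =>
    to_quotient K (j (s (f x))) : quotient_module K).
  move=> c x y; apply/eqP; rewrite -subr_eq0 -linearP -raddfB.
  apply/eqP/to_quotient_eq0; rewrite KE -linearP -raddfB.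
  apply/asboolP; exists (s (f (c *: x + y)) - (c *: s (f x) + s (f y))) => //.
  by rewrite linearB (linearP p) -!sP linearP subrr.
have [h hE] := linear_pack hlin.
have QInj : nonnil_injective (quotient_module K).
  apply: hdiv; exists E => //; exists (to_quotient K).
  exact: to_quotient_surj.
have [m mE] := nonnil_injective_extends h QInj Inonnil.
have [e eE] := to_quotient_surj m.
(* Since x e and j(s(f x)) agree modulo j(ker p), x e lies in the image of [j], over an element that
   [p] sends to f x. Injectivity of [j] then makes the chosen preimages linear in x. *)
have gP x : exists a, j a = val x *: e /\ p a = f x.
  have /eqP : h x = val x *: m by [].
  rewrite hE eE -linearZ eq_sym -subr_eq0 -raddfB => /eqP/to_quotient_eq0.
  rewrite KE => /asboolP[a a0 aE]; exists (a + s (f x)).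
  by rewrite !raddfD /= a0 add0r -sP -aE subrK.
have [g gE] := choice gP.
have glin : linear g.
  move=> c x y; apply: jinj; rewrite linearP.
  by rewrite !(proj1 (gE _)) scalerA scalerDl.
have [g' g'E] := linear_pack glin; exists g' => x.
by rewrite g'E (proj2 (gE x)).
Qed.

(** A section g of the free cover of [I] writes d as the finite sum of coeff_x(g d) x. Linearity
    gives a coeff_x(g d) = coeff_x(g(a d)) = d coeff_x(g a), hence the divisibility by d. *)
Lemma projective_dual_basis (I : submodClosed R^o) d :
    projective_module (ideal_module I) -> d \in I -> d \in regular_elt R ->
  exists s, dual_basis R I d s.
Proof.
move=> Iproj dI dreg; pose M : lmodType R := ideal_module I.
have [g gE] := Iproj {freeg M / R} M (fglift id) idfun (@free_cover_surj R M).
pose dM : M := Sub d dI.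
exists [seq (val x, coeff x (g dM)) | x : M <- dom (g dM)]; split=> //.
- by move=> _ /mapP[x _ ->]; exact: (valP x).
- rewrite big_map /=; have := congr1 val (gE dM).
  rewrite -{1}(freeg_sumE (g dM)) linear_sum.
  rewrite (raddf_sum (\val : ideal_module I -> R^o)) => dE.
  rewrite -[RHS]dE; apply: eq_bigr => x _ /=.
  by rewrite liftU mulrC.
- move=> a _ aI /mapP[x _ ->] /=; exists (coeff x (g (Sub a aI))).
  rewrite -!coeffZ -!linearZ; congr (coeff x (g _)); apply: val_inj.
  by rewrite /= [LHS]mulrC.
Qed.

Definition principal_pred (x : R) : {pred R^o} := principal_ideal x.

Lemma principal_submod_closed x : submod_closed (principal_pred x).
Proof.
split=> [|a _ _ /asboolP[r ->] /asboolP[s ->]]; apply/asboolP.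
  by exists 0; rewrite mulr0.
by exists (a * r + s); rewrite mulrDr mulrCA.
Qed.

HB.instance Definition _ x := GRing.isSubmodClosed.Build R R^o
  (principal_pred x) (principal_submod_closed x).

(** A section g of r |-> x r gives c = g(x) with x c = x, and x y = 0 forces c y = 0. As x (1 - c) =
    0 and Nil(R) is prime, 1 - c is nilpotent; then y = (1 - c)^n y for all n, so y = 0. *)
Lemma projective_principal_regular x :
    projective_module (ideal_module (principal_pred x)) ->
    x \notin nilradical R ->
  x \in regular_elt R.
Proof.
move=> xproj xN; pose M : lmodType R := ideal_module (principal_pred x).
have px (r : R) : (x * r : R^o) \in principal_pred x by apply/asboolP; exists r.
have plin : linear (fun r : R^o => Sub (x * r : R^o) (px r) : M).
  move=> a r t; apply: val_inj; rewrite /= mulrDr; congr (_ + _).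
  exact: mulrCA.
have [p pE] := linear_pack plin.
have [y|g gE] := xproj R^o M p idfun.
  by have /asboolP[r rE] := valP y; exists r; rewrite pE; apply: val_inj.
pose c : R := g (p 1).
have xc : x * c = x.
  have := congr1 val (gE (p 1)); rewrite /= [in RHS]pE /= mulr1 => e.
  by rewrite -[RHS]e (pE (g (p 1))).
apply/regular_eltP => y xy0.
have cy : c * y = 0.
  rewrite mulrC -[y * c]/(y *: (c : R^o)) -linearZ.
  have -> : y *: p 1 = 0.
    by rewrite pE; apply: val_inj; rewrite /= mulr1 [LHS]mulrC.
  by rewrite linear0.
have [_ prim _] := hR.
have /prim : x * (1 - c) \in nilradical R.
  by rewrite mulrBr mulr1 xc subrr; apply/asboolP; exists 1.
rewrite (negbTE xN) => /asboolP[n n0].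
have -> : y = (1 - c) ^+ n * y; last by rewrite n0 mul0r.
elim: n {n0} => [|n IHn]; first by rewrite mul1r.
by rewrite exprSr -mulrA mulrBl mul1r cy subr0.
Qed.

End NonnilIdeals.

Theorem theorem2p8 (R : comNzRingType) (hR : phi_ring R) :
  [<-> phi_Dedekind hR /\ strong_phi_ring R;
       forall M : lmodType R, divisible_module M -> nonnil_injective M;
       forall M : lmodType R, h_divisible_module M -> nonnil_injective M;
       forall I : submodClosed R^o,
         nonnil I -> projective_module (ideal_module I)].
Proof.
tfae.
- by case; apply: phi_Dedekind_nonnil_injective.
- by move=> H M /h_divisible_divisible; apply: H.
- by move=> H I; apply: nonnil_projective.
- move=> proj.
  have reg x : x \notin nilradical R -> x \in regular_elt R.
    move=> xN; apply: (projective_principal_regular hR _ xN); apply: proj.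
    by exists x => //; apply/asboolP; exists 1; rewrite mulr1.
  have Rstrong : strong_phi_ring R by apply/strong_phi_ringP.
  split=> // I Inonnil; apply/(phi_invertible_dual_basis hR Rstrong Inonnil).
  have [x xI xN] := Inonnil.
  have [s] := projective_dual_basis (proj I Inonnil) xI (reg x xN).
  by exists x, s.
Qed.
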